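(* Let $\varphi$ be a positive linear map on a unital $C^*$-algebra $\mathcal{A}$ and let $s>0$. The following are equivalent: (1) $r(\varphi)<s$; (2) there exists $w\ge0$ in $\mathcal{A}$ with $\varphi(w)=s(w-1)$; (3) there exists a strictly positive $v\in\mathcal{A}$ such that $\|\alpha_v^{-1}\circ\varphi\circ\alpha_v\|<s$; (4) there exists a positive map $\psi$ on $\mathcal{A}$ which is elementarily similar to $\varphi$ with $\|\psi\|<s$.
   Context: $r(\varphi)$ is the spectral radius of $\varphi$ as a bounded operator on $\mathcal{A}$, and $\|\cdot\|$ the operator norm. An element is strictly positive if it is positive and invertible. For $a\in\mathcal{A}$, $\alpha_a$ is the map $x\mapsto a^*xa$; for invertible $a$, $\alpha_a^{-1}$ denotes its inverse map $x\mapsto (a^* )^{-1}xa^{-1}$. A positive map $\varphi$ is elementarily similar to a positive map $\psi$ if there exists invertible $a\in\mathcal{A}$ with $\varphi=\alpha_a^{-1}\circ\psi\circ\alpha_a$. *)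

(* Defs.v *)
From HB Require Import structures.
From mathcomp Require Import all_boot all_order all_algebra.
From mathcomp Require Import all_classical all_reals all_analysis.
From mathcomp Require Import complex.
Set Implicit Arguments. Unset Strict Implicit. Unset Printing Implicit Defensive.
Import Order.TTheory GRing.Theory Num.Theory numFieldNormedType.Exports.
Local Open Scope ring_scope.
Local Open Scope classical_set_scope.

(* Real-valued norm of a normed space over C = R[i]
   (MathComp-Analysis norms over R[i] are valued in R[i], with zero imaginary part). *)
Definition cnorm (R : realType) (V : normedModType R[i]) (x : V) : R :=
  complex.Re `|x|.

Record cstar_alg (R : realType) (A : completeNormedModType R[i]) := CStarAlg {
  cmul : A -> A -> A;
  cone : A;
  cstar : A -> A;
  cmulA : associative cmul;
  cmul1l : left_id cone cmul;
  cmul1r : right_id cone cmul;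
  cmulDl : left_distributive cmul +%R;
  cmulDr : right_distributive cmul +%R;
  cmulZl : forall (c : R[i]) (a b : A), cmul (c *: a) b = c *: cmul a b;
  cmulZr : forall (c : R[i]) (a b : A), cmul a (c *: b) = c *: cmul a b;
  cstarK : involutive cstar;
  cstarD : forall a b : A, cstar (a + b) = cstar a + cstar b;
  cstarZ : forall (c : R[i]) (a : A), cstar (c *: a) = c^* *: cstar a;
  cstarM : forall a b : A, cstar (cmul a b) = cmul (cstar b) (cstar a);
  cnormM : forall a b : A, cnorm (cmul a b) <= cnorm a * cnorm b;
  cnorm_cstar : forall a : A, cnorm (cmul (cstar a) a) = cnorm a ^+ 2
}.

Section CStar.
Variables (R : realType) (A : completeNormedModType R[i]) (S : cstar_alg A).

Let mul := cmul S.
Let one := cone S.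
Let st := cstar S.

Definition cinvertible (a : A) : Prop := exists b : A, mul a b = one /\ mul b a = one.

(* the inverse of an invertible element (junk value a otherwise) *)
Definition cinv (a : A) : A :=
  match pselect (cinvertible a) with
  | left h => proj1_sig (cid h)
  | right _ => a
  end.

Definition cspectrum (a : A) : set R[i] :=
  [set l : R[i] | ~ cinvertible ((l *: one) - a)].

Definition cpositive (a : A) : Prop :=
  st a = a /\ cspectrum a `<=` [set l : R[i] | 0 <= l].

Definition cstrictly_positive (a : A) : Prop := cpositive a /\ cinvertible a.

Definition positive_map (f : A -> A) : Prop :=
  forall a, cpositive a -> cpositive (f a).

Definition alpha (a : A) : A -> A := fun x => mul (st a) (mul x a).
Definition alpha_inv (a : A) : A -> A := fun x => mul (cinv (st a)) (mul x (cinv a)).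

Definition elem_similar (phi psi : A -> A) : Prop :=
  exists a : A, cinvertible a /\ phi =1 alpha_inv a \o psi \o alpha a.

End CStar.

Definition opnorm (R : realType) (V : normedModType R[i]) (f : V -> V) : R :=
  sup [set cnorm (f x) | x in [set x : V | cnorm x <= 1]].

Definition op_invertible (R : realType) (V : normedModType R[i]) (T : V -> V) : Prop :=
  exists U : V -> V, linear U /\ continuous U /\ U \o T =1 id /\ T \o U =1 id.

Definition op_spectrum (R : realType) (V : normedModType R[i]) (T : V -> V) : set R[i] :=
  [set l : R[i] | ~ op_invertible (fun x : V => l *: x - T x)].

Definition spectral_radius (R : realType) (V : normedModType R[i]) (T : V -> V) : R :=
  sup [set complex.Re `|l| | l in op_spectrum T].

(* Main.v *)
Require Import Defs.
From HB Require Import structures.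
From mathcomp Require Import all_boot all_order all_algebra.
From mathcomp Require Import all_classical all_reals all_analysis.
From mathcomp Require Import complex.
From mathcomp Require Import cyclic separable cyclotomic ring lra zify.
Import Order.TTheory GRing.Theory Num.Theory numFieldNormedType.Exports.
Set Implicit Arguments. Unset Strict Implicit. Unset Printing Implicit Defensive.
Local Open Scope ring_scope.

(* If r(phi) < s, the resolvent (t - phi)^-1 exists for all real t >= s and is positive for large t;
   positivity propagates down to s, and w = s (s - phi)^-1 1.  Conversely phi w = s (w - 1) forces
   w >= 1, and v = w^(1/2) gives a positive map psi = alpha_v^-1 phi alpha_v with
   psi 1 = s (1 - w^-1), whose norm is less than s; by Russo-Dye that is the norm of psi.  Similar
   maps have the same spectrum, and the Neumann series bounds r(psi) by the norm of psi.

   Positivity is handled without functional calculus or Gelfand theory, through the condition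
   |t - x| <= t and square roots obtained from the iteration z <- (y + z^2) / 2.  Russo-Dye follows
   von Neumann: for |a| <= 1 the Fejer kernels of z a (|z| = 1) are positive, and a is recovered,
   up to a factor tending to 1, as their average over roots of unity with unimodular weights. *)

(** * The square-zero extension of a module *)

Definition sqzero (K : nzRingType) (V : lmodType K) : Type := (K * V)%type.

Section SquareZero.
Variables (K : comNzRingType) (V : lmodType K).
Local Notation T := (sqzero V).

HB.instance Definition _ := GRing.Zmodule.copy T (K * V)%type.

Definition sqz_one : T := (1, 0).
Definition sqz_mul (x y : T) : T := (x.1 * y.1, x.1 *: y.2 + y.1 *: x.2).

Lemma sqz_mulA : associative sqz_mul.
Proof.
move=> [a x] [b y] [c z]; congr (_, _) => /=; first by rewrite mulrA.
by rewrite !scalerDr !scalerA addrA (mulrC c a) (mulrC c b).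
Qed.

Lemma sqz_mulC : commutative sqz_mul.
Proof. by move=> [a x] [b y]; congr (_, _) => /=; rewrite (mulrC, addrC). Qed.

Lemma sqz_mul1 : left_id sqz_one sqz_mul.
Proof. by move=> [a x]; congr (_, _); rewrite /= (mul1r, scaler0) ?scale1r ?addr0. Qed.

Lemma sqz_mulD : left_distributive sqz_mul +%R.
Proof.
move=> [a x] [b y] [c z]; congr (_, _) => /=; first by rewrite mulrDl.
by rewrite scalerDl scalerDr addrACA.
Qed.

Lemma sqz_one_neq0 : sqz_one != 0.
Proof. by apply/eqP => -[] /eqP; rewrite oner_eq0. Qed.

HB.instance Definition _ := GRing.Zmodule_isComNzRing.Build T
  sqz_mulA sqz_mulC sqz_mul1 sqz_mulD sqz_one_neq0.

Definition sqz_scal (a : K) : T := (a, 0).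
Definition sqz_vec (x : V) : T := (0, x).

Lemma sqz_scal_is_additive : {morph sqz_scal : a b / a - b}.
Proof. by move=> a b; congr (_, _); rewrite /= subr0. Qed.

Lemma sqz_scal_is_multiplicative : multiplicative sqz_scal.
Proof. by split=> [a b|//]; congr (_, _); rewrite /= !scaler0 addr0. Qed.

HB.instance Definition _ := GRing.isAdditive.Build K T sqz_scal sqz_scal_is_additive.
HB.instance Definition _ :=
  GRing.isMultiplicative.Build K T sqz_scal sqz_scal_is_multiplicative.

Lemma sqz_vec_is_additive : {morph sqz_vec : x y / x - y}.
Proof. by move=> x y; congr (_, _); rewrite /= subr0. Qed.

HB.instance Definition _ := GRing.isAdditive.Build V T sqz_vec sqz_vec_is_additive.

Lemma sqz_vecE : ((forall x y : V, (sqz_vec (x + y) = sqz_vec x + sqz_vec y)%R) *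
  (forall x : V, (sqz_vec (- x) = - sqz_vec x)%R) *
  (forall (a : K) (x : V), (sqz_vec (a *: x) = sqz_scal a * sqz_vec x)%R))%type.
Proof.
split; first by split=> *; rewrite (raddfD, raddfN).
by move=> a x; congr (_, _); rewrite /= ?mulr0 // scale0r addr0.
Qed.

Lemma sqz_vec_inj : injective sqz_vec.
Proof. by move=> x y []. Qed.

End SquareZero.

(* The square-zero extension [K + V] is a commutative ring, so that linear identities in the
   module [V] become ring identities. *)
Ltac module := apply: sqz_vec_inj; rewrite ?sqz_vecE; ring.

Local Open Scope complex_scope.

(** * Norm, involution and self-adjoint elements *)

(* A copy of [A] carrying the ring structure given by [S]. It is only a [pzRingType], as the zero
   algebra is allowed. *)
Definition calg {R : realType} {A : completeNormedModType R[i]}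
  (S : cstar_alg A) : Type := A.

HB.instance Definition _ (R : realType) (A : completeNormedModType R[i])
  (S : cstar_alg A) := GRing.Lmodule.copy (calg S) A.

HB.instance Definition _ (R : realType) (A : completeNormedModType R[i])
    (S : cstar_alg A) :=
  GRing.Zmodule_isPzRing.Build (calg S)
    (cmulA S) (cmul1l S) (cmul1r S) (cmulDl S) (cmulDr S).

Reserved Notation "r %:S" (at level 2, format "r %:S").
Notation "r %:S" := (r%:C%C *: (1 : calg _)) : ring_scope.

Section NormAndStar.
Variables (R : realType) (A : completeNormedModType R[i]) (S : cstar_alg A).
Local Notation T := (calg S).
Implicit Types (a b x y : T) (c : R[i]) (r : R).

Definition star (x : T) : T := cstar S x.
Definition nrm (x : T) : R := cnorm (x : A).
Definition sa x := star x = x.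

Lemma nrmE (x : A) : (nrm (x : T))%:C = `|x|.
Proof.
apply: RRe_real; exact: normr_real.
Qed.

Lemma nrm_ge0 x : 0 <= nrm x.
Proof. by rewrite -lecR nrmE normr_ge0. Qed.

Lemma nrm0 : nrm 0 = 0.
Proof. by apply: complexI; rewrite nrmE normr0. Qed.

Lemma nrm_eq0 x : nrm x = 0 -> x = 0.
Proof. by move=> x0; apply: (@normr0_eq0 _ A); rewrite -nrmE x0. Qed.

Lemma nrm_le0 x : nrm x <= 0 -> x = 0.
Proof. by move=> x0; apply/nrm_eq0/le_anti; rewrite x0 nrm_ge0. Qed.

Lemma nrmD x y : nrm (x + y) <= nrm x + nrm y.
Proof. by rewrite -lecR rmorphD /= !nrmE ler_normD. Qed.

Lemma nrmN x : nrm (- x) = nrm x.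
Proof. by apply: complexI; rewrite !nrmE normrN. Qed.

Lemma nrmB x y : nrm (x - y) <= nrm x + nrm y.
Proof. by rewrite -(nrmN y) nrmD. Qed.

Lemma nrm_distC x y : nrm (x - y) = nrm (y - x).
Proof. by rewrite -nrmN opprB. Qed.

Lemma nrmZ c x : nrm (c *: x) = complex.Re `|c| * nrm x.
Proof.
apply: complexI; rewrite nrmE (normrZ c (x : A)) rmorphM /= nrmE.
by congr (_ * _); symmetry; apply: RRe_real; exact: normr_real.
Qed.

Lemma nrmZr r x : nrm (r%:C *: x) = `|r| * nrm x.
Proof. by rewrite nrmZ normc_def /= expr0n addr0 sqrtr_sqr. Qed.

Lemma nrmZ_ge0 r x : 0 <= r -> nrm (r%:C *: x) = r * nrm x.
Proof. by move=> r0; rewrite nrmZr ger0_norm. Qed.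

Lemma nrmM x y : nrm (x * y) <= nrm x * nrm y.
Proof. exact: cnormM. Qed.

Lemma starK x : star (star x) = x. Proof. exact: cstarK. Qed.
Lemma starM x y : star (x * y) = star y * star x. Proof. exact: cstarM. Qed.
Lemma starZ c x : star (c *: x) = conjc c *: star x. Proof. exact: cstarZ. Qed.
Lemma starZr r x : star (r%:C *: x) = r%:C *: star x.
Proof. by rewrite starZ conjc_real. Qed.

Lemma star_is_additive : {morph star : x y / x - y}.
Proof.
move=> x y; rewrite [LHS]cstarD; congr (_ + _).
have := starZ (- 1) y; have -> : conjc (- 1 : R[i]) = - 1 by rewrite rmorphN rmorph1.
by rewrite !scaleN1r.
Qed.

HB.instance Definition _ := GRing.isAdditive.Build T T star star_is_additive.

Lemma star1 : star 1 = 1.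
Proof. by have := starM 1 (star 1); rewrite mul1r starK mul1r. Qed.

Lemma nrm_star_mul x : nrm (star x * x) = nrm x ^+ 2.
Proof. exact: cnorm_cstar. Qed.

(** The C*-identity and submultiplicativity give |y|^2 <= |star y| |y|; after cancelling |y|, the
    bound is used for x and for [star x]. *)
Lemma nrm_star x : nrm (star x) = nrm x.
Proof.
suff le y : nrm y <= nrm (star y) by apply/le_anti; rewrite le andbT -{2}(starK x) le.
have [->|/eqP y0] := eqVneq (nrm y) 0; first exact: nrm_ge0.
have y_gt0 : 0 < nrm y by rewrite lt_def nrm_ge0 andbT; apply/eqP.
by rewrite -(ler_pM2r y_gt0) -expr2 -nrm_star_mul nrmM.
Qed.

Lemma nrm_sa_sqr x : sa x -> nrm (x * x) = nrm x ^+ 2.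
Proof. by move=> {1}<-; rewrite nrm_star_mul. Qed.

(** From |1| = |1|^2 the norm of 1 is 0 or 1; the value 0 occurs in the zero algebra. *)
Lemma nrm1_le1 : nrm 1 <= 1.
Proof.
have := nrm_star_mul 1; rewrite star1 mul1r expr2 => e.
have := nrm_ge0 1; nra.
Qed.

Lemma nrm_sqr_le x r : 0 <= r -> nrm x ^+ 2 <= r ^+ 2 -> nrm x <= r.
Proof. by move=> r0; rewrite ler_pXn2r // nnegrE ?nrm_ge0. Qed.

Lemma scaleAl c x y : (c *: x) * y = c *: (x * y). Proof. exact: cmulZl. Qed.
Lemma scaleAr c x y : x * (c *: y) = c *: (x * y). Proof. exact: cmulZr. Qed.

Lemma nrm_scal_le r : 0 <= r -> nrm r%:S <= r.
Proof. by move=> r0; rewrite nrmZ_ge0 // ler_piMr // nrm1_le1. Qed.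

Lemma comm_scal c x y : GRing.comm x y -> GRing.comm x (c *: y).
Proof. by rewrite /GRing.comm scaleAl scaleAr => ->. Qed.

Lemma sa1 : sa 1. Proof. exact: star1. Qed.
Lemma sa0 : sa 0. Proof. exact: raddf0. Qed.
Lemma saD x y : sa x -> sa y -> sa (x + y).
Proof. by rewrite /sa raddfD /= => -> ->. Qed.
Lemma saN x : sa x -> sa (- x).
Proof. by rewrite /sa raddfN /= => ->. Qed.
Lemma saB x y : sa x -> sa y -> sa (x - y).
Proof. by move=> sx sy; apply/saD/saN. Qed.
Lemma saZ r x : sa x -> sa (r%:C *: x).
Proof. by rewrite /sa starZr => ->. Qed.
Lemma saM x y : sa x -> sa y -> GRing.comm x y -> sa (x * y).
Proof. by rewrite /sa starM => -> ->. Qed.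
Lemma sa_star_mul x : sa (star x * x).
Proof. by rewrite /sa starM starK. Qed.

Lemma nrm_le_eps x y : (forall e, 0 < e -> nrm (x - y) <= e) -> x = y.
Proof.
move=> h; apply/eqP; rewrite -subr_eq0; apply/eqP/nrm_le0/ler_addgt0Pr => e e0.
by rewrite add0r h.
Qed.

End NormAndStar.

(** * Contractions and invertibility *)

Section Limits.
Variables (R : realType) (A : completeNormedModType R[i]) (S : cstar_alg A).
Local Notation T := (calg S).
Implicit Types (x y u : T) (r : R).

(** Majorant method: [q] has nonnegative increments and is bounded, so its tails are small, and they
    control the tails of [z], which is therefore Cauchy. *)
Lemma dominated_limit (z : nat -> T) (q : nat -> R) (M : R) :
  (forall n, nrm (z n.+1 - z n) <= q n.+1 - q n) -> (forall n, q n <= M) ->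
  exists l : T, forall e, 0 < e ->
    exists N, forall n, (N <= n)%N -> nrm (z n - l) <= e.
Proof.
move=> hz hM.
have dist n k : nrm (z (n + k)%N - z n) <= q (n + k)%N - q n.
  elim: k => [|k IH]; first by rewrite addn0 !subrr nrm0.
  have -> : z (n + k.+1)%N - z n = (z (n + k).+1 - z (n + k)%N) + (z (n + k)%N - z n).
    by rewrite addnS subrKA.
  by rewrite (le_trans (nrmD _ _)) // addnS; have := hz (n + k)%N; lra.
have supq : has_sup (range q) by split; [exists (q 0%N), 0%N | exists M => _ [n _ <-]].
have tailq e : 0 < e -> exists N, forall k, q (N + k)%N - q N <= e.
  move=> e0; have [_ [N _ <-] hN] := sup_adherent e0 supq.
  exists N => k; have : q (N + k)%N <= sup (range q) by apply: ub_le_sup; [case: supq | exists (N + k)%N].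
  by lra.
have : cauchy ((z : nat -> A) @ \oo)%classic.
  apply: cauchy_exP => e e0; have e_real : e = (complex.Re e)%:C by rewrite RRe_real // gtr0_real.
  have re0 : 0 < complex.Re e / 2 by rewrite divr_gt0 // -ltcR -e_real.
  have [N hN] := tailq _ re0; exists (z N); exists N => // n /= Nn.
  rewrite -ball_normE /= -(nrmE S) e_real ltcR nrm_distC -(subnKC Nn).
  by rewrite (le_lt_trans (dist _ _)) // (le_lt_trans (hN _)) //; lra.
move=> /cauchy_cvgP /cvgrPdist_le cv; exists (lim ((z : nat -> A) @ \oo)%classic) => e e0.
have [|N _ hN] := cv e%:C; first by rewrite ltcR.
by exists N => n Nn; rewrite nrm_distC -lecR (nrmE S); apply: hN.
Qed.

Definition affine_iter (K : T -> T) (u : T) (n : nat) : T := iter n (fun z => u + K z) 0.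

(** The iterates are the partial sums of the Neumann series with terms K^n u, dominated by a
    geometric series. *)
Lemma contraction_fixpoint (K : T -> T) (q : R) u : {morph K : x y / x - y} ->
  0 <= q < 1 -> (forall x, nrm (K x) <= q * nrm x) -> exists x, x = u + K x.
Proof.
move=> KB /andP[q0 q1] hK; pose z := affine_iter K u.
have step n : nrm (z n.+1 - z n) <= q ^+ n * nrm u.
  elim: n => [|n IH]; first by rewrite expr0 mul1r subr0 [z 1%N]/= -{1}(subrr 0) KB subrr addr0.
  have -> : z n.+2 - z n.+1 = K (z n.+1 - z n).
    by rewrite KB [z n.+2]/= {2}[z n.+1]/= opprD addrACA subrr add0r.
  by rewrite (le_trans (hK _)) // exprS -mulrA ler_wpM2l.
(* Closed form of the sum of q^k |u| over k < n. *)
pose p n := (1 - q ^+ n) / (1 - q) * nrm u.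
have q1' : 1 - q != 0 by rewrite subr_eq0 gt_eqF.
have [|n|l hl] := @dominated_limit z p (1 / (1 - q) * nrm u).
- move=> n; rewrite (le_trans (step n)) // le_eqVlt; apply/orP; left; apply/eqP.
  by rewrite /p exprS; field.
- rewrite ler_wpM2r ?nrm_ge0 // ler_wpM2r ?invr_ge0 ?subr_ge0 ?(ltW q1) //.
  by rewrite gerBl exprn_ge0.
exists l; apply: nrm_le_eps => e e0.
have [|N hN] := hl (e / 2); first lra.
have -> : l - (u + K l) = (l - z N.+1) + K (z N - l).
  by rewrite KB [z N.+1]/=; module.
rewrite (le_trans (nrmD _ _)) // nrm_distC.
have h1 := hN N.+1 (leqnSn N); have h2 := hN N (leqnn N); have := hK (z N - l).
have := nrm_ge0 (z N - l); nra.
Qed.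

(** The error of the n-th iterate is K^n x. Approximation by iterates started at 0 lets closed
    properties such as positivity pass to the fixed point. *)
Lemma affine_iter_cvg (K : T -> T) (q : R) u x : {morph K : x y / x - y} ->
  0 <= q < 1 -> (forall x, nrm (K x) <= q * nrm x) -> x = u + K x ->
  forall e, 0 < e -> exists n, nrm (x - affine_iter K u n) <= e.
Proof.
move=> KB /andP[q0 q1] hK xE e e0.
have dist n : nrm (x - affine_iter K u n) <= q ^+ n * nrm x.
  elim: n => [|n IH]; first by rewrite subr0 mul1r.
  rewrite {1}xE [affine_iter _ _ _]/= opprD addrACA subrr add0r -KB.
  by rewrite (le_trans (hK _)) // exprS -mulrA ler_wpM2l.
have q1' : `|q| < 1 by rewrite ger0_norm.
have /cvgrPdist_le /(_ e e0) [N _ /(_ N (leqnn N)) /=] :=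
  cvg_geometric (nrm x) q1'.
rewrite sub0r normrN ger0_norm ?mulr_ge0 ?exprn_ge0 ?nrm_ge0 // => h.
by exists N; rewrite (le_trans (dist N)) // mulrC.
Qed.

Definition invertible x := exists y, x * y = 1 /\ y * x = 1.

Lemma invertible_lr x y y' : x * y = 1 -> y' * x = 1 -> invertible x.
Proof.
by move=> xy y'x; exists y; split=> //; rewrite -[y]mul1r -y'x -(mulrA y') xy mulr1.
Qed.

Lemma invertible_comm_factor x y : GRing.comm x y -> invertible (x * y) -> invertible x.
Proof.
move=> cxy [z [xyz zxy]]; apply: (@invertible_lr x (y * z) (z * y)).
  by rewrite mulrA.
by rewrite -mulrA -cxy.
Qed.

Lemma invertibleZ (c : R[i]) x : c != 0 -> invertible x -> invertible (c *: x).
Proof.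
move=> c0 [y [xy yx]]; exists (c^-1 *: y).
by rewrite !scaleAl !scaleAr !scalerA mulfV // mulVf // !scale1r.
Qed.

Lemma neumann_invertible y : nrm y < 1 -> invertible (1 - y).
Proof.
move=> y1; have hq : 0 <= nrm y < 1 by rewrite nrm_ge0.
have [|b hb] := @contraction_fixpoint (fun x => y * x) _ 1 (mulrBr y) hq; first by move=> x; apply: nrmM.
have [|c hc] := @contraction_fixpoint (fun x => x * y) _ 1 (fun a b => mulrBl y a b) hq.
  by move=> x; rewrite mulrC; apply: nrmM.
apply: (@invertible_lr _ b c).
  by rewrite mulrBl mul1r {1}hb addrK.
by rewrite mulrBr mulr1 {1}hc addrK.
Qed.

Lemma invertible_perturb r x : nrm (r%:S - x) < r -> invertible x.
Proof.
move=> h; have r0 : 0 < r := le_lt_trans (nrm_ge0 _) h.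
have rC0 : r%:C != 0 by apply/eqP => -[] /eqP; rewrite gt_eqF.
have -> : x = r%:C *: (1 - r%:C^-1 *: (r%:S - x)).
  by rewrite scalerBr scalerA mulfV // scale1r subKr.
apply/invertibleZ/neumann_invertible => //.
by rewrite -fmorphV nrmZ_ge0 ?invr_ge0 ?(ltW r0) // mulrC ltr_pdivrMr // mul1r.
Qed.

End Limits.

(** * Square roots *)

Section SquareRoot.
Variables (R : realType) (A : completeNormedModType R[i]) (S : cstar_alg A).
Local Notation T := (calg S).
Implicit Types (x y z : T) (r : R).

Lemma nrm_le_mul_eps x y (C : R) :
  0 <= C -> (forall e, 0 < e -> nrm (x - y) <= C * e) -> x = y.
Proof.
move=> C0 h; apply: nrm_le_eps => e e0; have C1 : 0 < C + 1 by lra.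
have := h _ (divr_gt0 e0 C1) => /le_trans; apply.
by rewrite mulrCA ger_pMr // ler_pdivrMr // mul1r lerDl.
Qed.

(** A fixed point z satisfies 2 z = y + z^2, that is (1 - z)^2 = 1 - y. *)
Fixpoint sqrt_iter (y : T) (n : nat) : T :=
  if n is n'.+1 then (2^-1)%:C *: (y + sqrt_iter y n' * sqrt_iter y n') else 0.

(** The same recursion for the scalar y = 1; it stays in [0, 1] and majorizes the iteration for
    every y of norm at most 1. *)
Fixpoint sqrt_bound (n : nat) : R :=
  if n is n'.+1 then (1 + sqrt_bound n' ^+ 2) / 2 else 0.

Lemma sqrt_bound_itv n : 0 <= sqrt_bound n <= 1.
Proof. by elim: n => [|n IH] /=; nra. Qed.

Lemma sqrt_iter_bound y n : nrm y <= 1 -> nrm (sqrt_iter y n) <= sqrt_bound n.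
Proof.
move=> y1; elim: n => [|n IH] /=; first by rewrite nrm0.
rewrite nrmZ_ge0 ?invr_ge0 // mulrC ler_wpM2r ?invr_ge0 //.
have := nrmD y (sqrt_iter y n * sqrt_iter y n).
have := nrmM (sqrt_iter y n) (sqrt_iter y n); have := nrm_ge0 (sqrt_iter y n); nra.
Qed.

(** The factorization z z - w w = z (z - w) + (z - w) w holds without commutativity, and its scalar
    version is the recursion for the increments of [sqrt_bound]. *)
Lemma sqrt_iter_step y n : nrm y <= 1 ->
  nrm (sqrt_iter y n.+1 - sqrt_iter y n) <= sqrt_bound n.+1 - sqrt_bound n.
Proof.
move=> y1; elim: n => [|n IH].
  rewrite /= mulr0 subr0 addr0 nrmZ_ge0 ?invr_ge0 // expr0n /= addr0 subr0 mulrC.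
  by rewrite ler_wpM2r ?invr_ge0.
set z := sqrt_iter y n.+1 in IH *; set w := sqrt_iter y n in IH.
have -> : sqrt_iter y n.+2 - z = (2^-1)%:C *: (z * (z - w) + (z - w) * w).
  rewrite mulrBr mulrBl [LHS](_ : _ = (2^-1)%:C *: (y + z * z) - (2^-1)%:C *: (y + w * w)) //.
  by module.
rewrite nrmZ_ge0 ?invr_ge0 //.
have -> : sqrt_bound n.+2 - sqrt_bound n.+1 =
    2^-1 * (sqrt_bound n.+1 * (sqrt_bound n.+1 - sqrt_bound n) +
            (sqrt_bound n.+1 - sqrt_bound n) * sqrt_bound n).
  by rewrite /=; field.
rewrite ler_wpM2l ?invr_ge0 // (le_trans (nrmD _ _)) // lerD //.
  by rewrite (le_trans (nrmM _ _)) // ler_pM ?nrm_ge0 // sqrt_iter_bound.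
by rewrite (le_trans (nrmM _ _)) // ler_pM ?nrm_ge0 // sqrt_iter_bound.
Qed.

Lemma sqrt_iter_comm x y n : GRing.comm x y -> GRing.comm x (sqrt_iter y n).
Proof.
move=> xy; elim: n => [|n IH] /=; first exact: commr0.
by apply/comm_scal/commrD => //; apply: commrM.
Qed.

Lemma sqrt_iter_sa y n : sa y -> sa (sqrt_iter y n).
Proof.
move=> sy; elim: n => [|n IH] /=; first exact: sa0.
by apply/saZ/saD => //; apply: saM.
Qed.

(** The last clause, inherited by the limit from the iterates, substitutes for functional calculus:
    it makes roots of commuting elements commute. *)
Lemma sqrt_one_sub y : nrm y <= 1 -> exists z, [/\ nrm z <= 1,
  (1 - z) * (1 - z) = 1 - y, sa y -> sa z &
  forall x, GRing.comm x y -> GRing.comm x z].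
Proof.
move=> y1; have ub n : sqrt_bound n <= 1 by have /andP[] := sqrt_bound_itv n.
have zb n : nrm (sqrt_iter y n) <= 1 by exact: le_trans (sqrt_iter_bound n y1) _.
have [l hl] := dominated_limit (fun n => sqrt_iter_step n y1) ub.
have l1 : nrm l <= 1.
  apply/ler_addgt0Pr => e e0; have [N /(_ N (leqnn N)) hN] := hl _ e0.
  have := nrmB (sqrt_iter y N) (sqrt_iter y N - l); rewrite subKr.
  by have := zb N; lra.
exists l; split=> //.
- apply: (@nrm_le_mul_eps _ _ 4) => // e e0; have [N hN] := hl _ e0.
  set z := sqrt_iter y N in hN *.
  have zE : y + z * z = (2 : R)%:C *: sqrt_iter y N.+1.
    by rewrite /= -/z scalerA -rmorphM /= mulfV // scale1r.
  (* The defect is expressed through distances to the limit. As z and l have norm at most 1, it is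
     at most 2e + e + e, whence the constant 4. *)
  have -> : (1 - l) * (1 - l) - (1 - y) =
      (2 : R)%:C *: (sqrt_iter y N.+1 - l) - (z * (z - l) + (z - l) * l).
    by rewrite scalerBr -zE !mulrBr !mulrBl !mulr1 !mul1r; module.
  have := hN N.+1 (leqnSn N); have := hN N (leqnn N).
  rewrite -/z => h1 h2.
  have h3 := nrmB ((2 : R)%:C *: (sqrt_iter y N.+1 - l)) (z * (z - l) + (z - l) * l).
  have h4 := nrmD (z * (z - l)) ((z - l) * l).
  have h5 := nrmM z (z - l); have h6 := nrmM (z - l) l.
  have h7 := nrm_ge0 z; have h8 := nrm_ge0 l; have h9 := nrm_ge0 (z - l).
  have h10 := zb N.
  have : nrm ((2 : R)%:C *: (sqrt_iter y N.+1 - l)) = 2 * nrm (sqrt_iter y N.+1 - l).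
    by rewrite nrmZ_ge0.
  rewrite -/z in h10 *; nra.
- move=> sy; apply: (@nrm_le_mul_eps _ _ 2) => // e e0; have [N /(_ N (leqnn N)) hN] := hl _ e0.
  have -> : star l - l = (sqrt_iter y N - l) - star (sqrt_iter y N - l).
    by rewrite raddfB /= sqrt_iter_sa //; module.
  by have := nrmB (sqrt_iter y N - l) (star (sqrt_iter y N - l)); rewrite nrm_star; lra.
- move=> x xy; apply: (@nrm_le_mul_eps _ _ (2 * nrm x)) => [|e e0].
    by rewrite mulr_ge0 ?nrm_ge0.
  have [N /(_ N (leqnn N)) hN] := hl _ e0.
  have -> : x * l - l * x = (sqrt_iter y N - l) * x - x * (sqrt_iter y N - l).
    by rewrite mulrBr mulrBl (sqrt_iter_comm N xy); module.
  have := nrmB ((sqrt_iter y N - l) * x) (x * (sqrt_iter y N - l)).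
  have := nrmM (sqrt_iter y N - l) x; have := nrmM x (sqrt_iter y N - l).
  by have := nrm_ge0 x; nra.
Qed.

End SquareRoot.

(** * The positive cone *)

Section PositiveCone.
Variables (R : realType) (A : completeNormedModType R[i]) (S : cstar_alg A).
Local Notation T := (calg S).
Implicit Types (a b h x y z : T) (r t c : R).

(* A spectrum-free form of positivity; [cpositiveP] proves it equivalent to [cpositive]. *)
Definition pos x := sa x /\ exists t, 0 <= t /\ nrm (t%:S - x) <= t.

Lemma mulii : 'i * 'i = -1 :> R[i].
Proof. by rewrite -expr2 sqr_i. Qed.

Lemma starZi x : star ('i *: x) = - ('i *: star x).
Proof.
rewrite starZ -scaleNr; congr (_ *: _).
by apply/eqP; rewrite eq_complex /= oppr0 !eqxx.
Qed.

Lemma sa_real r : sa (r%:S : T). Proof. exact/saZ/sa1. Qed.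

Lemma comm_real x r : GRing.comm x (r%:S).
Proof. exact/comm_scal/commr1. Qed.

Lemma posD x y : pos x -> pos y -> pos (x + y).
Proof.
move=> [sx [t [t0 xt]]] [sy [u [u0 yu]]]; split; first exact: saD.
exists (t + u); split; first exact: addr_ge0.
have -> : (t + u)%:S - (x + y) = (t%:S - x) + (u%:S - y) by module.
by rewrite (le_trans (nrmD _ _)) // lerD.
Qed.

Lemma posZ r x : 0 <= r -> pos x -> pos (r%:C *: x).
Proof.
move=> r0 [sx [t [t0 xt]]]; split; first exact: saZ.
exists (r * t); split; first exact: mulr_ge0.
have -> : (r * t)%:S - r%:C *: x = r%:C *: (t%:S - x) by module.
by rewrite nrmZ_ge0 // ler_wpM2l.
Qed.

Lemma pos_real r : 0 <= r -> pos (r%:S : T).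
Proof.
by move=> r0; split; [exact: sa_real | exists r; rewrite subrr nrm0].
Qed.

Lemma pos0 : pos (0 : T).
Proof. by have := pos_real (lexx 0); rewrite rmorph0 scale0r. Qed.

Lemma pos_sum (I : Type) (s : seq I) (F : I -> T) :
  (forall i, pos (F i)) -> pos (\sum_(i <- s) F i).
Proof.
move=> hF; elim: s => [|i s IH]; first by rewrite big_nil; exact: pos0.
by rewrite big_cons; apply: posD.
Qed.

Lemma pos_real_sub x r : sa x -> nrm x <= r -> pos (r%:S - x).
Proof.
move=> sx xr; split; first exact/saB/sx/sa_real.
by exists r; rewrite subKr (le_trans (nrm_ge0 x)).
Qed.

Lemma pos_real_add x r : sa x -> nrm x <= r -> pos (r%:S + x).
Proof.
by move=> sx xr; rewrite -(opprK x); apply: pos_real_sub; rewrite ?nrmN //; exact: saN.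
Qed.

(** If |t - x| <= t with t > 0, then x = t (1 - y) with |y| <= 1, and the root is sqrt t (1 - z)
    with (1 - z)^2 = 1 - y. The bound |z| <= 1 makes it positive, with witness sqrt t. *)
Lemma pos_sqrt x : pos x -> exists y, [/\ pos y, y * y = x &
  forall z, GRing.comm z x -> GRing.comm z y].
Proof.
move=> [sx [t [t0 xt]]]; have [t_eq0|tn0] := eqVneq t 0.
  exists 0; split; [exact: pos0| |by move=> z _; exact: commr0].
  move: xt; rewrite t_eq0 rmorph0 scale0r sub0r nrmN mulr0.
  by move=> /nrm_le0 ->.
have t_gt0 : 0 < t by rewrite lt_def tn0.
have [|z [z1 zz sz cz]] := @sqrt_one_sub _ _ S (t^-1%:C *: (t%:S - x)).
  by rewrite nrmZ_ge0 ?invr_ge0 // mulrC ler_pdivrMr // mul1r.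
have sz' : sa z by apply/sz/saZ/saB => //; apply: sa_real.
have st : Num.sqrt t * Num.sqrt t = t by rewrite -expr2 sqr_sqrtr.
exists ((Num.sqrt t)%:C *: (1 - z)); split.
- split; first exact/saZ/saB/sz'/sa1.
  exists (Num.sqrt t); split; first exact: sqrtr_ge0.
  have -> : (Num.sqrt t)%:S - (Num.sqrt t)%:C *: (1 - z) = (Num.sqrt t)%:C *: z by module.
  by rewrite nrmZ_ge0 ?sqrtr_ge0 // ler_piMr ?sqrtr_ge0.
- rewrite scaleAl scaleAr scalerA -rmorphM /= st zz scalerBr !scalerA -rmorphM /=.
  by rewrite mulfV // scale1r subKr.
- move=> y yx; apply/comm_scal/commrB; first exact: commr1.
  by apply/cz/comm_scal/commrB => //; exact: comm_real.
Qed.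

(* [a + i b] is a multiple of a unitary, and [a^2 - b^2] is the real part of its square. *)
Lemma nrm_sub_sqr_le a b c : sa a -> sa b -> GRing.comm a b -> 0 <= c ->
  a * a + b * b = c%:S -> nrm (a * a - b * b) <= c.
Proof.
move=> sa_a sb cab c0 abc; pose u := a + 'i *: b; pose v := a - 'i *: b.
have vE : star u = v.
  by rewrite raddfD /= starZi sa_a sb.
have vu : v * u = c%:S.
  rewrite -abc /v /u mulrBl !mulrDr !scaleAl !scaleAr scalerA mulii cab.
  by module.
have uu : u * u + v * v = (2 : R)%:C *: (a * a - b * b).
  rewrite /v /u !mulrBl !mulrBr !mulrDl !mulrDr !scaleAl !scaleAr !scalerA mulii cab.
  by module.
have : nrm u ^+ 2 <= c by rewrite -nrm_star_mul vE vu nrm_scal_le.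
have := nrmD (u * u) (v * v); rewrite uu nrmZ_ge0 //.
have := nrmM u u; have := nrmM v v; rewrite -vE nrm_star; lra.
Qed.

(** The roots a of c + h and b of c - h commute, a^2 + b^2 = 2c and a^2 - b^2 = 2h, so
    [nrm_sub_sqr_le] turns the order bound into a norm bound. *)
Lemma pos_nrm_le h c : 0 <= c -> pos (c%:S + h) -> pos (c%:S - h) -> nrm h <= c.
Proof.
move=> c0 /pos_sqrt[a [[sa_a _] aa ca]] /pos_sqrt[b [[sb _] bb cb]].
have cab : GRing.comm a b.
  apply: cb; apply/commr_sym/ca/commrD; first exact: comm_real.
  by apply/commr_sym/commrB => //; exact: comm_real.
have c0' : 0 <= 2 * c by lra.
have := nrm_sub_sqr_le sa_a sb cab c0'; rewrite aa bb.
have -> : c%:S + h - (c%:S - h) = (2 : R)%:C *: h by module.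
by rewrite nrmZ_ge0 // ler_pM2l //; apply; module.
Qed.

(** For k the root of c - h^2, [nrm_sub_sqr_le] bounds h^2 - k^2 = 2 h^2 - c by c; halving gives
    |c/2 - h^2| <= c/2. *)
Lemma pos_sqr h : sa h -> pos (h * h).
Proof.
move=> sh; have shh : sa (h * h) by exact: saM.
have [c [c0 hc]] : exists c, 0 <= c /\ nrm (h * h) <= c by exists (nrm (h * h)); rewrite nrm_ge0.
have /pos_sqrt[k [[sk _] kk ck]] : pos (c%:S - h * h).
  exact: pos_real_sub.
have chk : GRing.comm h k.
  by apply/ck/commrB; [exact: comm_real | exact: commrM].
have := nrm_sub_sqr_le sh sk chk c0; rewrite kk addrC subrK => /(_ erefl) le_c.
have [d [d0 d2]] : exists d : R, 0 <= d /\ d * 2 = 1 by exists 2^-1; rewrite invr_ge0 mulVf.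
split=> //; exists (d * c); split; first exact: mulr_ge0.
have {1}-> : h * h = d%:C *: ((2 : R)%:C *: (h * h)).
  by rewrite scalerA -rmorphM /= d2 scale1r.
have -> : (d * c)%:S - d%:C *: ((2 : R)%:C *: (h * h)) = - (d%:C *: (h * h - (c%:S - h * h))).
  by module.
by rewrite nrmN nrmZ_ge0 // ler_wpM2l.
Qed.

(** Both t - (t - x) = x and t + (t - x) = 2t - x are positive, so [pos_nrm_le] applies. Any bound
    of the norm can thus serve as the witness in [pos]. *)
Lemma pos_nrm_sub x t : pos x -> nrm x <= t -> nrm (t%:S - x) <= t.
Proof.
move=> px xt; have t0 : 0 <= t := le_trans (nrm_ge0 x) xt.
apply: pos_nrm_le => //; last by rewrite subKr.
have -> : t%:S + (t%:S - x) = (t + t)%:S - x by module.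
by apply: pos_real_sub; [case: px | lra].
Qed.

Lemma pos_closed x :
  (forall e, 0 < e -> exists y, pos y /\ nrm (x - y) <= e) -> pos x.
Proof.
move=> hx; split.
  apply: (@nrm_le_mul_eps _ _ _ _ _ 2) => // e /hx[y [[sy _] xy]].
  have -> : star x - x = star (x - y) - (x - y) by rewrite raddfB /= sy; module.
  by have := nrmB (star (x - y)) (x - y); rewrite nrm_star; lra.
exists (nrm x + 1); split; first by have := nrm_ge0 x; lra.
apply/ler_addgt0Pr => e e0.
(* The cap 1 keeps |y| <= |x| + 1, so the witness |x| + 1 works for every approximant. *)
have [|y [py xy]] := hx (Order.min e 1); first by rewrite lt_min e0 /=.
move: xy; rewrite le_min => /andP[xye xy1].
have hy : nrm y <= nrm x + 1.
  by have := nrmB x (x - y); rewrite subKr; lra.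
have -> : (nrm x + 1)%:S - x = ((nrm x + 1)%:S - y) - (x - y) by module.
rewrite (le_trans (nrmB _ _)) // lerD //; exact: pos_nrm_sub.
Qed.

Lemma pos_add_invertible x t : pos x -> 0 < t -> invertible (t%:S + x).
Proof.
move=> [sx [u [u0 xu]]] t0; apply: (@invertible_perturb _ _ _ (u + t)).
have -> : (u + t)%:S - (t%:S + x) = u%:S - x by module.
lra.
Qed.

Lemma sa_inverse x y : sa x -> x * y = 1 -> y * x = 1 -> sa y.
Proof.
move=> sx xy yx; rewrite /sa -[star y]mulr1 -xy mulrA.
by rewrite -{1}sx -starM xy star1 mul1r.
Qed.

(** With y the root of x, z its inverse, c > |z^2| and m the root of c - z^2, one has (y m)^2 = c x
    - 1, so x - 1/c is a positive multiple of a square. *)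
Lemma pos_invertible_sub x : pos x -> invertible x ->
  exists e, 0 < e /\ pos (x - e%:S).
Proof.
move=> /pos_sqrt[y [[sy _] <- _]] /(invertible_comm_factor (erefl : GRing.comm y y)).
move=> [z [yz zy]]; have sz := sa_inverse sy yz zy.
have szz : sa (z * z) by exact: saM.
pose c := nrm (z * z) + 1; have c0 : 0 < c by have := nrm_ge0 (z * z); rewrite /c; lra.
have /pos_sqrt[m [[sm _] mm cm]] : pos (c%:S - z * z).
  by apply: pos_real_sub => //; rewrite /c; lra.
have cym : GRing.comm y m.
  apply/cm/commrB; first exact: comm_real.
  by apply: commrM; rewrite /GRing.comm yz zy.
exists c^-1; split; first by rewrite invr_gt0.
have -> : y * y - c^-1%:S = c^-1%:C *: ((y * m) * (y * m)).
  rewrite {2}cym mulrA -(mulrA y m m) mm mulrBr mulrBl -(mulrA y (z * z)).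
  rewrite -(mulrA z) zy mulr1 yz scalerBr scaleAr mulr1 scaleAl scalerA.
  by rewrite -rmorphM /= mulVf ?gt_eqF // scale1r.
apply: posZ; first by rewrite invr_ge0 ltW.
by apply: pos_sqr; apply: saM.
Qed.

(** The infimum of the t >= 0 with t + h positive is attained because the cone is closed. Were it
    nonzero, inf + h would be positive and invertible, and [pos_invertible_sub] would lower it. *)
Lemma pos_of_invertible h : sa h -> (forall t, 0 < t -> invertible (t%:S + h)) -> pos h.
Proof.
move=> sh hinv; pose E := [set t : R | 0 <= t /\ pos (t%:S + h)]%classic.
have E0 : has_inf E.
  split; last by exists 0 => t [].
  by exists (nrm h); split; [exact: nrm_ge0 | exact: pos_real_add].
have t0 : 0 <= inf E by apply: lb_le_inf; [case: E0 | move=> t []].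
have pinf : pos ((inf E)%:S + h).
  apply: pos_closed => e e0; have [t [t_ge0 pt] te] := inf_adherent e0 E0.
  exists (t%:S + h); split=> //.
  have -> : (inf E)%:S + h - (t%:S + h) = - (t - inf E)%:S by module.
  have tinf : inf E <= t by apply: ge_inf => //; case: E0.
  rewrite nrmN; have := @nrm_scal_le _ _ S (t - inf E); lra.
have [inf0|infN0] := eqVneq (inf E) 0.
  by move: pinf; rewrite inf0 rmorph0 scale0r add0r.
have inf_gt0 : 0 < inf E by rewrite lt_def infN0.
have [e [e0 pe]] := pos_invertible_sub pinf (hinv _ inf_gt0).
have : E (inf E - Order.min e (inf E)).
  split; first by rewrite subr_ge0 ge_min lexx orbT.
  have -> : (inf E - Order.min e (inf E))%:S + h =
      ((inf E)%:S + h - e%:S) + (e - Order.min e (inf E))%:S by module.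
  by apply/posD/pos_real => //; rewrite subr_ge0 ge_min lexx.
move=> /(ge_inf (proj2 E0)); rewrite leNgt gtrBl lt_min e0 inf_gt0.
by [].
Qed.

Lemma invertibleN x : invertible x -> invertible (- x).
Proof.
by move=> ix; rewrite -scaleN1r; apply: invertibleZ => //; rewrite oppr_eq0 oner_eq0.
Qed.

Lemma cpositiveP x : cpositive S x <-> pos x.
Proof.
split=> [[sx spec]|px].
  apply: pos_of_invertible => // t t0; apply: contrapT => ninv.
  suff : 0 <= (- t)%:C :> R[i] by rewrite lecR; lra.
  apply: spec => inv; apply: ninv.
  have -> : t%:S + x = - ((- t)%:S - x) by module.
  exact: invertibleN.
split=> [|l ninv]; first by case: px.
have sx : sa x by case: px.
apply: contrapT => l_nge0; apply: ninv; change (invertible (l *: (1 : T) - x)).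
have lE : l = (complex.Re l)%:C + 'i * (complex.Im l)%:C := complexE l.
have [im0|imN0] := eqVneq (complex.Im l) 0.
  have lr : l = (complex.Re l)%:C by rewrite {1}lE im0 mulr0 addr0.
  have re_lt0 : complex.Re l < 0 by rewrite ltNge; apply/negP => re0; apply: l_nge0; rewrite /= lr lecR.
  have -> : l *: (1 : T) - x = - ((- complex.Re l)%:S + x) by rewrite {1}lr; module.
  by apply/invertibleN/pos_add_invertible => //; lra.
(* Non-real l = r + i m: with y = x - r and w = i m, the product (y - w)(y + w) = m^2 + y^2 is
   invertible, hence so is its commuting factor y - w. *)
pose y := x - (complex.Re l)%:S; have sy : sa y by apply/saB/sa_real.
pose w : T := ('i * (complex.Im l)%:C) *: (1 : T).
have -> : l *: (1 : T) - x = - (y - w) by rewrite {1}lE /y /w; module.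
have yw : GRing.comm y w by exact/comm_scal/commr1.
have ww : w * w = - (complex.Im l ^+ 2)%:S.
  rewrite /w scaleAl scaleAr mulr1 scalerA -scaleNr; congr (_ *: _).
  by rewrite mulrCA -mulrA mulrA mulii mulN1r expr2 rmorphM.
clearbody y w; apply: invertibleN; apply: (@invertible_comm_factor _ _ _ _ (y + w)).
  by apply: commrD; apply/commr_sym/commrB; do ?[exact: commr_refl | exact: commr_sym].
have -> : (y - w) * (y + w) = (complex.Im l ^+ 2)%:S + y * y.
  by rewrite mulrDr !mulrBl ww yw; module.
apply: pos_add_invertible; first exact: pos_sqr.
by rewrite exprn_even_gt0.
Qed.

End PositiveCone.

(** * Positivity of [star a * a] and sums with unimodular weights *)

Section StarMul.
Variables (R : realType) (A : completeNormedModType R[i]) (S : cstar_alg A).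
Local Notation T := (calg S).
Implicit Types (a b p x y z : T) (r t c : R).

Lemma pos_eq x y : pos x -> x = y -> pos y.
Proof. by move=> px <-. Qed.

(** If z inverts t - x y, then (1 + y z x) / t inverts t - y x. *)
Lemma invertible_swap x y t : t != 0 ->
  invertible (t%:S - x * y) -> invertible (t%:S - y * x).
Proof.
move=> t0 [z [xyz zxy]]; exists (t^-1%:C *: (1 + y * (z * x))).
have tV : t^-1%:C * t%:C = 1 :> R[i] by rewrite -rmorphM /= mulVf.
split.
  rewrite scaleAr mulrDr mulr1 mulrBl.
  have -> : y * x * (y * (z * x)) = y * (x * y * z) * x by rewrite !mulrA.
  have -> : x * y * z = t%:C *: z - 1.
    by move: xyz; rewrite mulrBl scaleAl mul1r => <-; rewrite subKr.
  rewrite mulrBr mulr1 mulrBl !(scaleAl, scaleAr) mul1r !mulrA.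
  by rewrite [X in _ *: X](_ : _ = t%:S) ?scalerA ?tV ?scale1r //; module.
rewrite scaleAl mulrDl mul1r mulrBr.
have -> : y * (z * x) * (y * x) = y * (z * (x * y)) * x by rewrite !mulrA.
have -> : z * (x * y) = t%:C *: z - 1.
  by move: zxy; rewrite mulrBr scaleAr mulr1 => <-; rewrite subKr.
rewrite mulrBr mulr1 mulrBl !(scaleAl, scaleAr) mulr1 !mulrA.
by rewrite [X in _ *: X](_ : _ = t%:S) ?scalerA ?tV ?scale1r //; module.
Qed.

Lemma pos_swap x : pos (- (star x * x)) -> pos (- (x * star x)).
Proof.
move=> px; apply: pos_of_invertible => [|t t0].
  by apply: saN; rewrite -{1}(starK x); exact: sa_star_mul.
by apply: invertible_swap; [rewrite gt_eqF | exact: pos_add_invertible].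
Qed.

Lemma pos_antisym x : pos x -> pos (- x) -> x = 0.
Proof.
move=> px nx; apply: nrm_le0; apply: pos_nrm_le => //.
  by rewrite rmorph0 scale0r add0r.
by rewrite rmorph0 scale0r sub0r.
Qed.

(** The sum [star x * x + x * star x] is half of (x + star x)^2 + (i (x - star x))^2, hence
    positive. By [pos_swap] its second term is negative, so the first is positive as well as
    negative. *)
Lemma star_mul_eq0 x : pos (- (star x * x)) -> star x * x = 0.
Proof.
move=> nx; have nx' := pos_swap nx.
have sp : sa (x + star x) by rewrite /sa raddfD /= starK addrC.
have sq : sa ('i *: (x - star x)).
  by rewrite /sa starZi raddfB /= starK -scalerN opprB.
have pq := posD (pos_sqr sp) (pos_sqr sq).
have p2 := posD pq (posZ (ler0n R 2) nx').
have x2 : (2%:R : R)%:C *: (star x * x) = 0.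
  apply: pos_antisym; last by rewrite -scalerN; exact: posZ.
  apply: pos_eq p2 _.
  rewrite scaleAl scaleAr scalerA mulii !mulrDl !mulrDr !mulNr !mulrN.
  by module.
have -> : star x * x = (2^-1)%:C *: ((2%:R : R)%:C *: (star x * x)).
  by rewrite scalerA -rmorphM /= mulVf // scale1r.
by rewrite x2 scaler0.
Qed.

(* With [k = |h|] and [g = |h| - h] (twice the negative part of [h]), [star (a g) (a g) = - k g^2]. *)
Lemma pos_star_mul a : pos (star a * a).
Proof.
pose h := star a * a; have sh : sa h := sa_star_mul a.
have /pos_sqrt[k [pk kk ck]] := pos_sqr sh; have sk : sa k by case: pk.
have hk : GRing.comm h k by apply/ck/commrM.
have /pos_sqrt[r [[sr _] rr cr]] := pk.
have hr : GRing.comm h r by exact: cr.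
have kr : GRing.comm k r by exact: cr.
pose g := k - h; have sg : sa g by exact: saB.
have rg : GRing.comm r g by apply: commrB; exact: commr_sym.
have gh : g * h = - (k * g).
  by rewrite /g mulrBl mulrBr -/h -kk; module.
have cc : star (a * g) * (a * g) = - ((r * g) * (r * g)).
  rewrite starM sg -mulrA (mulrA (star a)) -/h mulrA gh mulNr -rr.
  by rewrite -(mulrA r r) {1}rg !mulrA.
have prg : pos ((r * g) * (r * g)) by apply/pos_sqr/saM.
have : star (a * g) * (a * g) = 0 by apply: star_mul_eq0; rewrite cc opprK.
rewrite cc => /eqP; rewrite oppr_eq0 => /eqP rgrg.
have kgg : k * g * g = 0 by rewrite -rgrg -rr -(mulrA r r) {1}rg !mulrA.
(* Since h and k commute and h^2 = k^2, g^2 = 2 k g. Then g^4 = 2 (k g g) g = 0, and the C*-identity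
   yields g = 0, so h equals the positive k. *)
have gg : g * g = (2 : R)%:C *: (k * g).
  by rewrite {1}/g mulrBl {2}/g /g !mulrBr hk -/h -kk; module.
have gggg : (g * g) * (g * g) = 0.
  by rewrite {1}gg scaleAl mulrA kgg mul0r scaler0.
have sgg : sa (g * g) by exact: saM.
have ng : nrm g = 0.
  have := nrm_sa_sqr sgg; rewrite gggg nrm0 (nrm_sa_sqr sg) -exprM => /esym/eqP.
  by rewrite expf_eq0 => /andP[_ /eqP].
have : k - h = 0 by exact: nrm_eq0.
by move=> /subr0_eq e; rewrite -/h -e.
Qed.

Lemma pos_conj b p : pos p -> pos (star b * (p * b)).
Proof.
move=> /pos_sqrt[y [[sy _] <- _]].
have -> : star b * (y * y * b) = star (y * b) * (y * b) by rewrite starM sy !mulrA.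
exact: pos_star_mul.
Qed.

(* The operator inequality behind the proof is
   [0 <= sum_k star (w_k t - c) p_k (w_k t - c)] with [w_k] the conjugate of [z_k] and
   [t = sum_k z_k p_k]; it bounds [star t * t] by [c * sum_k p_k]. *)
Lemma nrm_sum_unimodular_le (I : finType) (z : I -> R[i]) (p : I -> T) (c : R) :
  (forall k, conjc (z k) * z k = 1) -> (forall k, pos (p k)) -> 0 < c ->
  nrm (\sum_k p k) <= c -> nrm (\sum_k z k *: p k) <= c.
Proof.
move=> z1 pp c0 pc; set P := \sum_k p k in pc; set t := \sum_k z k *: p k.
have sP : sa P by have [] := pos_sum (index_enum I) pp.
have st : star t = \sum_k conjc (z k) *: p k.
  by rewrite raddf_sum; apply: eq_bigr => k _; rewrite /= starZ; have [->] := pp k.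
have cauchy : pos (star t * (P * t) - (2 * c)%:C *: (star t * t) + (c ^+ 2)%:C *: P).
  apply: pos_eq (pos_sum (index_enum I)
    (fun k => pos_conj (conjc (z k) *: t - c%:S) (pp k))) _.
  symmetry.
  have -> : star t * (P * t) - (2 * c)%:C *: (star t * t) + (c ^+ 2)%:C *: P =
     star t * (P * t) - c%:C *: (star t * t) - c%:C *: (star t * t) + (c ^+ 2)%:C *: P.
    by module.
  rewrite {3}st {4}/t /P !(mulr_suml, mulr_sumr, scaler_sumr) -!sumrN -!big_split.
  apply: eq_bigr => k _ /=; rewrite raddfB /= starZ conjcK starZr star1.
  rewrite !mulrBl !mulrBr !scaleAl !scaleAr !mul1r !mulr1 !scalerA.
  have z1k : z k * conjc (z k) = 1 by rewrite mulrC.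
  rewrite z1k scale1r.
  by module.
(* Adding [h1] and [h2] to [cauchy] cancels the terms in P and leaves c (c^2 - star t * t). *)
have h1 : pos (star t * ((c%:S - P) * t)) by apply/pos_conj/pos_real_sub.
have h2 : pos ((c ^+ 2)%:C *: (c%:S - P)) by apply: posZ; [rewrite exprn_ge0 ?ltW | exact: pos_real_sub].
have pct : pos (c%:C *: ((c ^+ 2)%:S - star t * t)).
  apply: pos_eq (posD (posD cauchy h1) h2) _.
  by rewrite mulrBl mulrBr scaleAl scaleAr mul1r; module.
have ptt : pos ((c ^+ 2)%:S - star t * t).
  have cV : 0 <= c^-1 by rewrite invr_ge0 ltW.
  by have := posZ cV pct; rewrite scalerA -rmorphM /= mulVf ?gt_eqF // scale1r.
apply: nrm_sqr_le; first exact: ltW.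
rewrite -nrm_star_mul; apply: pos_nrm_le ptt; first by rewrite exprn_ge0 ?ltW.
by apply/posD/pos_star_mul/pos_real; rewrite exprn_ge0 ?ltW.
Qed.

Lemma nrm_sum_unimodular (I : finType) (z : I -> R[i]) (p : I -> T) :
  (forall k, conjc (z k) * z k = 1) -> (forall k, pos (p k)) ->
  nrm (\sum_k z k *: p k) <= nrm (\sum_k p k).
Proof.
move=> z1 pp; apply/ler_addgt0Pr => e e0; apply: nrm_sum_unimodular_le => //.
  by have := nrm_ge0 (\sum_k p k); lra.
by rewrite lerDl ltW.
Qed.

End StarMul.

(** * The Russo-Dye inequality *)

Section RussoDye.
Variables (R : realType) (A : completeNormedModType R[i]) (S : cstar_alg A).
Local Notation T := (calg S).
Implicit Types (a b x : T).

(** By separability X^(n+1) - 1 has n + 1 distinct roots, hence a primitive one, w. For 0 < j <= n,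
    w^j differs from 1 while its (n+1)-th power is 1, so its geometric sum vanishes. *)
Lemma unity_roots n : exists z : 'I_n.+1 -> R[i],
  (forall k, conjc (z k) * z k = 1) /\
  (forall j, (0 < j <= n)%N -> \sum_k z k ^+ j = 0).
Proof.
pose p : {poly R[i]} := 'X^(n.+1) - 1; have [r Dp] := closed_field_poly_normal p.
have n_gt0 : (0 < n.+1)%N by [].
rewrite (monicP _) ?monicXnsubC // scale1r in Dp.
have rn1 : all (n.+1).-unity_root r by apply/allP=> z; rewrite -root_prod_XsubC -Dp.
have sz_r : (n.+1 < (size r).+1)%N by rewrite -(size_prod_XsubC r id) -Dp size_XnsubC.
have [|w _ prim_w] := hasP (has_prim_root n_gt0 rn1 _ sz_r).
  by rewrite -separable_prod_XsubC -Dp separable_Xn_sub_1 // pnatr_eq0.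
exists (fun k => w ^+ k); split=> [k|j /andP[j0 jn]].
  rewrite mulrC -sqr_normc normrX.
  have /eqP : `|w| ^+ n.+1 = 1 by rewrite -normrX (prim_expr_order prim_w) normr1.
  by rewrite pexpr_eq1 // => /eqP ->; rewrite !expr1n.
have wj : w ^+ j != 1.
  by rewrite -(prim_order_dvd prim_w) gtnNdvd.
have := subrX1 (w ^+ j) n.+1; rewrite -exprM mulnC exprM (prim_expr_order prim_w).
rewrite expr1n subrr => /esym/eqP; rewrite mulf_eq0 subr_eq0 (negPf wj) /= => /eqP e; rewrite -[RHS]e.
by apply: eq_bigr => k _; rewrite -!exprM mulnC.
Qed.

Definition geom_sum b (l : nat) : T := \sum_(j < l.+1) b ^+ j.

(* [geom_sum b l + star (geom_sum b l) - 1] is the partial sum of order [l] of the Poisson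
   kernel of [b]; its Cesaro means are the Fejer kernels. *)
Definition fejer b (n : nat) : T :=
  \sum_(l < n) (geom_sum b l + star (geom_sum b l) - 1).

Lemma geom_sumS b l : geom_sum b l.+1 = 1 + b * geom_sum b l.
Proof.
rewrite /geom_sum big_ord_recl expr0 mulr_sumr; congr (_ + _).
by apply: eq_bigr => j _; rewrite exprS.
Qed.

(** Write G_l for [geom_sum b l] and |y|^2 for [star y * y]. As G_(l+1) = 1 + b G_l, the summand of
    order l + 1 is |G_(l+1)|^2 - |b G_l|^2; regrouping the sum yields the factors [1 - star b * b],
    positive for |b| <= 1. *)
Lemma fejerS b n : fejer b n.+1 = star (geom_sum b n) * geom_sum b n +
  \sum_(l < n) star (geom_sum b l) * ((1 - star b * b) * geom_sum b l).
Proof.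
elim: n => [|n IH].
  rewrite /fejer big_ord_recl !big_ord0 /geom_sum big_ord_recl big_ord0 expr0.
  by rewrite !addr0 star1 mulr1 addrK.
rewrite /fejer big_ord_recr -/(fejer b n.+1) IH /= [in RHS]big_ord_recr /=.
rewrite !geom_sumS; set g := geom_sum b n; set s := \sum_(l < n) _.
rewrite mulrBl mulrBr mul1r raddfD /= star1 starM !(mulrDl, mulrDr) !(mul1r, mulr1) !mulrA.
by module.
Qed.

Lemma fejer_pos b n : nrm b <= 1 -> pos (fejer b n).
Proof.
case: n => [|n] b1; first by rewrite /fejer big_ord0; exact: pos0.
rewrite fejerS; apply/posD/pos_sum => [|l]; first exact: pos_star_mul.
apply: pos_conj; have := @pos_real_sub _ _ S (star b * b) 1 (sa_star_mul b).
rewrite rmorph1 scale1r; apply; rewrite nrm_star_mul.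
by have := nrm_ge0 b; nra.
Qed.

Lemma exprZ_calg (c : R[i]) a j : (c *: a) ^+ j = c ^+ j *: a ^+ j.
Proof.
elim: j => [|j IH]; first by rewrite !expr0 scale1r.
by rewrite !exprS IH scaleAl scaleAr scalerA.
Qed.

Lemma sum_geom_sum (I : finType) (c z : I -> R[i]) a l :
  \sum_k c k *: geom_sum (z k *: a) l =
  \sum_(j < l.+1) (\sum_k c k * z k ^+ j) *: a ^+ j.
Proof.
under eq_bigr do rewrite scaler_sumr; rewrite exchange_big /=; apply: eq_bigr => j _.
by rewrite scaler_suml; apply: eq_bigr => k _; rewrite exprZ_calg scalerA.
Qed.

(** * Averages of Fejer kernels over roots of unity *)

Section Averages.
Variables (m : nat) (z : 'I_m.+2 -> R[i]).
Hypothesis z_unit : forall k, conjc (z k) * z k = 1.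
Hypothesis z_sum : forall j, (0 < j <= m.+1)%N -> \sum_k z k ^+ j = 0.

Lemma sum_conj_unity j : (0 < j <= m.+1)%N -> \sum_k conjc (z k) ^+ j = 0.
Proof.
move=> jm; have := congr1 (@conjc R) (z_sum jm); rewrite rmorph_sum rmorph0 => e.
by rewrite -[RHS]e; apply: eq_bigr => k _; rewrite rmorphXn.
Qed.

Lemma sum_geom a l : (l <= m)%N -> \sum_k geom_sum (z k *: a) l = 1 *+ m.+2.
Proof.
move=> lm; transitivity (\sum_k 1 *: geom_sum (z k *: a) l).
  by apply: eq_bigr => k _; rewrite scale1r.
rewrite sum_geom_sum big_ord_recl [X in _ + X]big1 => [|j _].
  rewrite addr0 expr0 -scaler_nat; congr (_ *: _).
  by under eq_bigr do rewrite mulr1; rewrite sumr_const card_ord.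
rewrite (eq_bigr (fun k => z k ^+ bump 0 j)) => [|k _]; last exact: mul1r.
by rewrite z_sum ?scale0r // /bump /=; have := ltn_ord j; lia.
Qed.

(** Only the power 0 survives summation over the roots; it contributes 1 + 1 - 1 = 1 for each order
    l and each root. *)
Lemma sum_fejer a : \sum_k fejer (z k *: a) m.+1 = 1 *+ m.+2 *+ m.+1.
Proof.
rewrite /fejer exchange_big /= (eq_bigr (fun=> 1 *+ m.+2)) => [|l _].
  by rewrite sumr_const card_ord.
have lm : (l <= m)%N by rewrite -ltnS.
rewrite sumrB big_split /= (sum_geom _ lm) -raddf_sum (sum_geom _ lm).
by rewrite raddfMn /= star1 sumr_const card_ord addrK.
Qed.

Lemma sum_conj_geom a l : (l <= m)%N ->
  \sum_k conjc (z k) *: geom_sum (z k *: a) l = if l is 0 then 0 else a *+ m.+2.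
Proof.
move=> lm; rewrite sum_geom_sum big_ord_recl.
have -> : \sum_k conjc (z k) * z k ^+ 0 = 0.
  rewrite -[RHS](@sum_conj_unity 1) //; apply: eq_bigr => k _.
  by rewrite mulr1 expr1.
rewrite scale0r add0r; case: l lm => [|l] lm; first by rewrite big_ord0.
rewrite big_ord_recl [X in _ + X]big1 => [|j _].
  rewrite addr0 expr1 -scaler_nat; congr (_ *: _).
  by under eq_bigr do rewrite expr1 z_unit; rewrite sumr_const card_ord.
have -> : \sum_k conjc (z k) * z k ^+ lift ord0 (lift ord0 j) = \sum_k z k ^+ j.+1.
  apply: eq_bigr => k _; rewrite /= /bump /= !add1n exprS mulrA z_unit mul1r.
  by [].
by rewrite z_sum ?scale0r //; have := ltn_ord j; lia.
Qed.

Lemma sum_conj_star_geom a l : (l <= m)%N ->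
  \sum_k conjc (z k) *: star (geom_sum (z k *: a) l) = 0.
Proof.
move=> lm; transitivity (star (\sum_k z k *: geom_sum (z k *: a) l)).
  by rewrite raddf_sum; apply: eq_bigr => k _; rewrite /= starZ.
rewrite sum_geom_sum big1 ?raddf0 // => j _.
rewrite (eq_bigr (fun k => z k ^+ j.+1)) => [|k _]; last by rewrite exprS.
by rewrite z_sum ?scale0r //; have := ltn_ord j; lia.
Qed.

(** The weight lowers the exponent of the root by one in [geom_sum] and raises that of its conjugate
    by one in the adjoint, up to m + 1; hence m + 2 roots. Only the first power of a survives, and
    it is absent for l = 0, which leaves m of the m + 1 orders. *)
Lemma sum_conj_fejer a : \sum_k conjc (z k) *: fejer (z k *: a) m.+1 = a *+ m.+2 *+ m.
Proof.
rewrite /fejer; under eq_bigr do rewrite scaler_sumr.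
rewrite exchange_big /=.
rewrite (eq_bigr (fun l : 'I_m.+1 => if (l : nat) is 0 then 0 else a *+ m.+2)) => [|l _].
  by rewrite big_ord_recl add0r sumr_const card_ord.
under eq_bigr do rewrite scalerBr scalerDr.
have lm : (l <= m)%N by rewrite -ltnS.
rewrite sumrB big_split /= (sum_conj_geom _ lm) (sum_conj_star_geom _ lm).
have z1 : \sum_k conjc (z k) = 0 by rewrite -[RHS](@sum_conj_unity 1).
by rewrite addr0 -scaler_suml z1 scale0r subr0.
Qed.

End Averages.

Lemma nrmMn x n : nrm (x *+ n) = nrm x *+ n.
Proof.
by rewrite -scaler_nat -(rmorph_nat (real_complex R)) nrmZ_ge0 // mulr_natl.
Qed.

Lemma russo_dye (f : {linear T -> T}) a :
  (forall x, pos x -> pos (f x)) -> nrm a <= 1 -> nrm (f a) <= nrm (f 1).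
Proof.
move=> fpos a1.
(* The images of the kernels under f are positive, so [nrm_sum_unimodular] compares the sums m (m +
   2) f a and (m + 1) (m + 2) f 1; the factor m + 2 cancels. *)
have key m : nrm (f a) *+ m <= nrm (f 1) *+ m.+1.
  have [z [z_unit z_sum]] := unity_roots m.+1.
  have nz k : nrm (z k *: a) <= 1.
    suff -> : nrm (z k *: a) = nrm a by [].
    apply/eqP; rewrite -(eqrXn2 (_ : 0 < 2)%N) ?nrm_ge0 // -!nrm_star_mul.
    by rewrite starZ scaleAl scaleAr scalerA z_unit scale1r.
  have := @nrm_sum_unimodular _ _ S _ (fun k => conjc (z k)) (fun k => f (fejer (z k *: a) m.+1)).
  rewrite -raddf_sum sum_fejer // (eq_bigr (fun k => f (conjc (z k) *: fejer (z k *: a) m.+1))).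
    rewrite -raddf_sum sum_conj_fejer // !raddfMn !nrmMn -!mulrnA mulnC (mulnC _ m.+1) !mulrnA.
    rewrite lerMn2r /=; apply.
      by move=> k; rewrite conjcK mulrC.
    by move=> k; apply/fpos/fejer_pos.
  by move=> k _; rewrite linearZ.
rewrite leNgt; apply/negP => lt_fa.
have d0 : 0 < nrm (f a) - nrm (f 1) by rewrite subr_gt0.
(* An integer m above |f 1| / (|f a| - |f 1|) contradicts [key]. *)
have := archi_boundP (divr_ge0 (nrm_ge0 (f 1)) (ltW d0)).
move: (Num.bound _) (key (Num.bound (nrm (f 1) / (nrm (f a) - nrm (f 1))))) => m.
rewrite ltr_pdivrMr // mulrSr -[X in X <= _]mulr_natl -[X in _ <= X + _]mulr_natl.
by move: (m%:R : R) => M; rewrite mulrBr; lra.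
Qed.

End RussoDye.

(** * Spectral radius and resolvents *)

Section Operators.
Variables (R : realType) (A : completeNormedModType R[i]) (S : cstar_alg A).
Local Notation T := (calg S).
Implicit Types (f U : T -> T) (x y : T) (l : R[i]).

Lemma Re_normV l : complex.Re `|l^-1| = (complex.Re `|l|)^-1.
Proof. by rewrite (normfV l) normc_def -fmorphV. Qed.

Lemma continuous_bounded f : linear f -> continuous (f : A -> A) ->
  exists C : R, 0 < C /\ forall x, nrm (f x) <= C * nrm x.
Proof.
move=> linf cf.
pose F : {linear A -> A} := HB.pack (f : A -> A) (GRing.isLinear.Build R[i] A A *:%R f linf).
have /linear_bounded_continuous /linear_boundedP /pinfty_ex_gt0 [r r0 hr] : continuous F := cf.
have rE : r = (complex.Re r)%:C by rewrite RRe_real // gtr0_real.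
exists (complex.Re r); split; first by rewrite -ltcR -rE.
by move=> x; rewrite -lecR rmorphM /= -rE !nrmE; exact: hr.
Qed.

Lemma bounded_continuous f (C : R) : linear f ->
  (forall x, nrm (f x) <= C * nrm x) -> continuous (f : A -> A).
Proof.
move=> linf hf.
pose F : {linear A -> A} := HB.pack (f : A -> A) (GRing.isLinear.Build R[i] A A *:%R f linf).
have bF : bounded_near F (nbhs (0 : A)).
  apply/linear_boundedP; exists C%:C; split; first by rewrite complex_real.
  move=> M CM x; apply: (@le_trans _ _ (C%:C * `|x|)).
    by rewrite -!(nrmE S) -rmorphM lecR; exact: hf.
  by rewrite ler_wpM2r // ltW.
by have /linear_bounded_continuous := bF.
Qed.

Lemma linear_morphB f : linear f -> {morph f : x y / x - y}.
Proof. by move=> lf x y; rewrite addrC -scaleN1r lf scaleN1r addrC. Qed.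

Lemma linear_morphZ f l x : linear f -> f (l *: x) = l *: f x.
Proof.
by move=> lf; rewrite -[l *: x]addr0 lf -{1}(subrr 0) (linear_morphB lf) subrr addr0.
Qed.

(** The Neumann series solves l u - f u = x for each x; uniqueness of u makes the chosen solution
    linear in x, and |l| |u| <= |x| + c |u| makes it bounded. *)
Lemma op_invertible_of_bound f (c : R) l : linear f ->
  (forall x, nrm (f x) <= c * nrm x) -> 0 <= c -> c < complex.Re `|l| ->
  op_invertible (fun x : A => l *: x - (f : A -> A) x).
Proof.
move=> lf hf c0 cl; set m := complex.Re `|l| in cl.
have m0 : 0 < m := le_lt_trans c0 cl.
have l0 : l != 0 by apply/eqP => l0; move: m0; rewrite /m l0 normr0 ltxx.
have inj x : l *: x - f x = 0 -> x = 0.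
  move=> /subr0_eq e; apply: nrm_le0.
  have := hf x; rewrite -e nrmZ -/m; have := nrm_ge0 x; nra.
have fB := linear_morphB lf.
have solve x : exists u, l *: u - f u = x.
  have [|||u uE] := @contraction_fixpoint _ _ S (fun y => l^-1 *: f y) (c / m) (l^-1 *: x).
  - by move=> y z; rewrite fB scalerBr.
  - by rewrite divr_ge0 ?(ltW m0) //= ltr_pdivrMr // mul1r.
  - move=> y; rewrite nrmZ Re_normV -/m mulrC mulrAC ler_wpM2r ?invr_ge0 ?(ltW m0) //.
  - exists u; rewrite {1}uE scalerDr !scalerA mulfV // !scale1r.
    by rewrite addrK.
have /choice[U hU] := solve; exists U.
have Uinj x y : l *: y - f y = x -> U x = y.
  move=> e; apply/subr0_eq/inj; rewrite fB scalerBr.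
  rewrite (_ : _ - _ = (l *: U x - f (U x)) - (l *: y - f y)); last by module.
  by rewrite hU e subrr.
have lU : linear U.
  move=> a x y; apply: Uinj; rewrite lf -[in RHS](hU x) -[in RHS](hU y); module.
split; first exact: lU.
split; last by split=> x /=; [exact: Uinj | exact: hU].
apply: (@bounded_continuous U (m - c)^-1 lU) => x.
rewrite mulrC ler_pdivlMr ?subr_gt0 //.
have e : l *: U x = x + f (U x) by rewrite -[X in X + _](hU x) subrK.
have := nrmD x (f (U x)); rewrite -e nrmZ -/m.
by have := hf (U x); lra.
Qed.

Lemma spectral_radius_lt f (c s : R) : 0 <= c -> c < s ->
  (forall l, c < complex.Re `|l| -> op_invertible (fun x : A => l *: x - (f : A -> A) x)) ->
  spectral_radius (f : A -> A) < s.
Proof.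
move=> c0 cs hinv; apply: le_lt_trans cs.
have ub : ubound [set complex.Re `|l| | l in op_spectrum (f : A -> A)]%classic c.
  by move=> _ [l lspec <-]; rewrite leNgt; apply/negP => cl; exact/lspec/hinv.
rewrite /spectral_radius.
(* An empty spectrum would have supremum 0, which is at most c; nonemptiness of the spectrum need
   not be shown. *)
have [->|/set0P ne] := eqVneq [set complex.Re `|l| | l in op_spectrum (f : A -> A)]%classic set0.
  by rewrite sup0.
exact: ge_sup.
Qed.

Lemma spectral_radius_invertible f (c s t : R) : 0 < s ->
  (forall l, c < complex.Re `|l| -> op_invertible (fun x : A => l *: x - (f : A -> A) x)) ->
  spectral_radius (f : A -> A) < s -> s <= t ->
  op_invertible (fun x : A => t%:C *: x - (f : A -> A) x).
Proof.
move=> s0 hinv hs st; apply: contrapT => tspec.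
have ub : has_ubound [set complex.Re `|l| | l in op_spectrum (f : A -> A)]%classic.
  by exists c => _ [l lspec <-]; rewrite leNgt; apply/negP => cl; exact/lspec/hinv.
have : t <= spectral_radius (f : A -> A).
  apply: ub_le_sup => //; exists t%:C => //.
  by rewrite normc_def /= expr0n addr0 sqrtr_sqr ger0_norm // (le_trans (ltW s0)).
lra.
Qed.

Lemma opnorm_le f (c : R) :
  (forall x, nrm x <= 1 -> nrm (f x) <= c) -> opnorm (f : A -> A) <= c.
Proof.
move=> hf; apply: ge_sup; last by move=> _ [x x1 <-]; exact: hf.
exists (cnorm (f 0)), (0 : A) => //.
by rewrite /= -[cnorm _]/(nrm (0 : T)) nrm0.
Qed.

(* The library's supremum of an unbounded set is [0], hence the boundedness hypothesis. *)
Lemma le_opnorm f (c : R) : linear f ->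
  (forall x, nrm x <= 1 -> nrm (f x) <= c) ->
  forall x, nrm (f x) <= opnorm (f : A -> A) * nrm x.
Proof.
move=> lf hf x.
have [x0|x0] := eqVneq (nrm x) 0.
  by rewrite (nrm_eq0 x0) -{1}(subrr 0) (linear_morphB lf) subrr !nrm0 mulr0.
have x_gt0 : 0 < nrm x by rewrite lt_def x0 nrm_ge0.
rewrite -ler_pdivrMr // mulrC -nrmZ_ge0 ?invr_ge0 ?nrm_ge0 // -(linear_morphZ _ _ lf).
apply: ub_le_sup; first by exists c => _ [y y1 <-]; exact: hf.
exists ((nrm x)^-1%:C *: x) => //; change (nrm ((nrm x)^-1%:C *: x) <= 1).
by rewrite nrmZ_ge0 ?invr_ge0 ?nrm_ge0 // mulVf.
Qed.

(** The iterates started at 0 are positive, and the cone is closed. *)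
Lemma contraction_fixpoint_pos (K : T -> T) (q : R) u x : {morph K : x y / x - y} ->
  0 <= q < 1 -> (forall x, nrm (K x) <= q * nrm x) -> (forall x, pos x -> pos (K x)) ->
  pos u -> x = u + K x -> pos x.
Proof.
move=> KB q01 hK Kpos pu xE; apply: pos_closed => e e0.
have [n hn] := affine_iter_cvg KB q01 hK xE e0; exists (affine_iter K u n); split=> //.
by elim: n {hn} => [|n IH] /=; [exact: pos0 | apply/posD/Kpos].
Qed.

(* The resolvent is positive for large [t], and the set of [t >= s] where it is positive is
   closed and open to the left, so it reaches [s]. *)
Lemma resolvent_pos f (c s : R) : linear f -> 0 <= c -> 0 < s ->
  (forall x, nrm (f x) <= c * nrm x) -> (forall x, pos x -> pos (f x)) ->
  (forall t, s <= t -> op_invertible (fun x : A => t%:C *: x - (f : A -> A) x)) ->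
  forall x, pos (s%:C *: x - f x) -> pos x.
Proof.
move=> lf c0 s0 hf fpos inv; have fB := linear_morphB lf.
have resolvent t : s <= t -> exists U C, [/\ linear U, 0 < C,
    forall x, nrm (U x) <= C * nrm x, forall x, U (t%:C *: x - f x) = x &
    forall x, t%:C *: U x - f (U x) = x].
  move=> st; have [U [lU [cU [Ul Ur]]]] := inv t st.
  by have [C [C0 hC]] := continuous_bounded lU cU; exists U, C; split.
pose E := [set t : R | s <= t /\ forall x, pos (t%:C *: x - f x) -> pos x]%classic.
have E_inf : has_inf E.
  split; last by exists s => t [].
  (* At t = s + c, x is the fixed point of y -> (t x - f x) / t + f y / t, a contraction of ratio c
     / (s + c). *)
  exists (s + c); split; first by rewrite lerDl.
  have t0 : 0 < s + c by lra.
  move=> x px; apply: (@contraction_fixpoint_pos (fun y => (s + c)^-1%:C *: f y)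
      (c / (s + c)) ((s + c)^-1%:C *: ((s + c)%:C *: x - f x))).
  - by move=> y z; rewrite fB scalerBr.
  - by rewrite divr_ge0 ?(ltW t0) //= ltr_pdivrMr // mul1r ltrDr.
  - by move=> y; rewrite nrmZ_ge0 ?invr_ge0 ?(ltW t0) // mulrC mulrAC ler_wpM2r ?invr_ge0 ?(ltW t0).
  - by move=> y py; apply/posZ/fpos => //; rewrite invr_ge0 ltW.
  - by apply: posZ px; rewrite invr_ge0 ltW.
  - by rewrite -scalerDr subrK scalerA -rmorphM /= mulVf ?gt_eqF // scale1r.
set t0 := inf E.
have st0 : s <= t0 by apply: lb_le_inf; [case: E_inf | move=> t []].
have [U [C [lU C0 hU Ul Ur]]] := resolvent t0 st0.
have UB := linear_morphB lU.
have t0_pos x : pos (t0%:C *: x - f x) -> pos x.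
  move=> px; apply: pos_closed => e e0.
  (* As N exceeds both e and |x|, the bound on t - t0 gives (t - t0) C <= 1/2, so |y| <= 2 |x| and
     |x - y| <= (t - t0) C (2 N) <= e. *)
  pose N := nrm x + 1 + e; have N0 : 0 < N by have := nrm_ge0 x; rewrite /N; lra.
  have d0 : 0 < e / (2 * C * N) by rewrite divr_gt0 // !mulr_gt0.
  have [t [st tpos] tlt] := inf_adherent d0 E_inf.
  have t0t : t0 <= t by apply: ge_inf => //; case: E_inf.
  have [V [D [_ _ _ _ Vr]]] := resolvent t st.
  pose y := V (t0%:C *: x - f x); exists y; split; first by apply: tpos; rewrite Vr.
  have xyE : x - y = (t - t0)%:C *: U y.
    rewrite -[LHS]Ul -(linear_morphZ _ _ lU); congr U.
    rewrite fB; have : t%:C *: y - f y = t0%:C *: x - f x by exact: Vr.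
    move=> /(congr1 (fun z => z - (t0%:C *: y - f y))) e1.
    rewrite [LHS](_ : _ = t0%:C *: x - f x - (t0%:C *: y - f y)); last by module.
    by rewrite -e1; module.
  have tt0 : 0 <= t - t0 by rewrite subr_ge0.
  have n1 : nrm (x - y) <= (t - t0) * (C * nrm y).
    by rewrite xyE nrmZ_ge0 // ler_wpM2l.
  have n2 : nrm y <= nrm x + nrm (x - y) by have := nrmB x (x - y); rewrite subKr.
  have n3 : (t - t0) * C * (2 * N) <= e.
    have : (t - t0) * (2 * C * N) <= e.
      by rewrite -ler_pdivlMr ?mulr_gt0 // lerBlDl ltW.
    by rewrite (_ : (t - t0) * C * (2 * N) = (t - t0) * (2 * C * N)) //; ring.
  have g0 : 0 <= (t - t0) * C by rewrite mulr_ge0 // ltW.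
  rewrite mulrA in n1; move: ((t - t0) * C) g0 n1 n3 => g g0 n1 n3.
  have x0 := nrm_ge0 x; have xy0 := nrm_ge0 (x - y); have y0 := nrm_ge0 y.
  have g1 : g <= 2^-1.
    have : g * (2 * N) <= N by rewrite (le_trans n3) // /N; lra.
    rewrite mulrA ger_pMl //; lra.
  rewrite /N in n3; nra.
have [t0s|t0s] := eqVneq t0 s; first by rewrite -t0s.
have {t0s} t0_gt : s < t0 by rewrite lt_def t0s.
(* The first bound keeps t0 - h >= s; the second makes h U a contraction, so that x = U ((t0 - h) x
   - f x) + h U x is positive whenever (t0 - h) x - f x is. *)
pose h := Order.min (t0 - s) (2 * C)^-1.
have h0 : 0 < h by rewrite lt_min subr_gt0 t0_gt invr_gt0 mulr_gt0.
have hC : h * C <= 2^-1.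
  have -> : 2^-1 = (2 * C)^-1 * C by field; rewrite gt_eqF.
  by rewrite ler_wpM2r ?(ltW C0) // ge_min lexx orbT.
have Upos x : pos x -> pos (U x) by move=> px; apply: t0_pos; rewrite Ur.
have : E (t0 - h).
  split; first by rewrite lerBrDr -lerBrDl ge_min lexx.
  move=> x px; apply: (@contraction_fixpoint_pos (fun y => h%:C *: U y) (h * C)
      (U ((t0 - h)%:C *: x - f x))).
  - by move=> y z; rewrite UB scalerBr.
  - by rewrite mulr_ge0 ?(ltW h0) ?(ltW C0) //=; lra.
  - by move=> y; rewrite nrmZ_ge0 ?(ltW h0) // -mulrA ler_wpM2l // ltW.
  - by move=> y py; apply/posZ/Upos => //; rewrite ltW.
  - exact: Upos.
  - rewrite addrC -lU -[LHS]Ul; congr U.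
    by module.
move=> /(ge_inf (proj2 E_inf)); rewrite -/t0; lra.
Qed.

End Operators.

(** * Similarity *)

Section Similarity.
Variables (R : realType) (A : completeNormedModType R[i]) (S : cstar_alg A).
Local Notation T := (calg S).
Implicit Types (f : T -> T) (a b v w x y : T).

Lemma cinvP a : invertible a -> a * (cinv S a : T) = 1 /\ (cinv S a : T) * a = 1.
Proof. by rewrite /cinv; case: pselect => // h _; exact: (proj2_sig (cid h)). Qed.

Lemma alpha_linear a : linear (alpha S a : T -> T).
Proof.
move=> l x y; change (star a * ((l *: x + y) * a) =
  l *: (star a * (x * a)) + star a * (y * a)).
by rewrite mulrDl mulrDr scaleAl scaleAr.
Qed.

Lemma alpha_bounded a x : nrm (alpha S a x : T) <= nrm a ^+ 2 * nrm x.
Proof.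
change (nrm (star a * (x * a)) <= nrm a ^+ 2 * nrm x).
rewrite (le_trans (nrmM _ _)) // nrm_star expr2 -mulrA ler_wpM2l ?nrm_ge0 //.
by rewrite mulrC nrmM.
Qed.

Lemma alpha_pos a x : pos x -> pos (alpha S a x : T).
Proof. exact: pos_conj. Qed.

Lemma alphaK a b : a * b = 1 -> cancel (alpha S a : T -> T) (alpha S b).
Proof.
move=> ab x; change (star b * (star a * (x * a) * b) = x).
by rewrite -!mulrA ab mulr1 mulrA -starM ab star1 mul1r.
Qed.

(** By uniqueness of inverses [cinv S (star a)] is the adjoint of [cinv S a]; so [alpha_inv] is
    itself a conjugation and inherits linearity and positivity. *)
Lemma alpha_invE a x : invertible a -> alpha_inv S a x = alpha S (cinv S a) x.
Proof.
move=> ia; have [ab ba] := cinvP ia; set b : T := cinv S a in ab ba.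
have isa : invertible (star a).
  by exists (star b); rewrite -!starM ab ba star1.
have [sc cs] := cinvP isa; set c : T := cinv S (star a) in sc cs.
change (c * (x * b) = star b * (x * b)); congr (_ * _).
by rewrite -[c]mul1r -star1 -ab starM -mulrA sc mulr1.
Qed.

(** The resolvent of g is the conjugate of the resolvent V of f. *)
Lemma op_invertible_conj f g a b l : a * b = 1 -> b * a = 1 ->
  (forall x, g x = alpha S a (f (alpha S b x))) ->
  op_invertible (fun x : A => l *: x - (f : A -> A) x) ->
  op_invertible (fun x : A => l *: x - (g : A -> A) x).
Proof.
move=> ab ba gE [V [lV [cV [Vl Vr]]]].
have [C [C0 hC]] := continuous_bounded (lV : linear (V : T -> T)) cV.
pose U : T -> T := fun x => alpha S a (V (alpha S b x)).
have aB := linear_morphB (alpha_linear a); have bB := linear_morphB (alpha_linear b).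
have aZ := linear_morphZ _ _ (alpha_linear a); have bZ := linear_morphZ _ _ (alpha_linear b).
have lU : linear U.
  by move=> k x y; rewrite /U alpha_linear; have /= -> := lV k (alpha S b x) (alpha S b y);
    rewrite alpha_linear.
exists U; split; first exact: lU.
split; first last.
  split=> x.
    change (alpha S a (V (alpha S b (l *: x - g x))) = x).
    rewrite bB bZ gE (alphaK ab) [V _](Vl (alpha S b x)); exact: (alphaK ba).
  change (l *: U x - g (U x) = x); rewrite gE /U (alphaK ab) -aZ -aB.
  have e : l *: (V (alpha S b x) : T) - f (V (alpha S b x)) = alpha S b x := Vr _.
  by rewrite e; exact: (alphaK ba).
apply: (@bounded_continuous _ _ _ U (nrm a ^+ 2 * (C * nrm b ^+ 2)) lU) => x.
rewrite (le_trans (alpha_bounded _ _)) // -(mulrA (nrm a ^+ 2)) -(mulrA C) ler_wpM2l ?exprn_ge0 ?nrm_ge0 //.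
apply: le_trans (hC _) _; rewrite ler_wpM2l ?(ltW C0) //; exact: alpha_bounded.
Qed.

Lemma positive_mapP f : positive_map S f <-> forall x, pos x -> pos (f x).
Proof.
by split=> h x /cpositiveP px; apply/cpositiveP/h.
Qed.

(** Russo-Dye also supplies automatic continuity, which makes [opnorm] a genuine supremum. *)
Lemma positive_bounded (f : {linear T -> T}) : positive_map S f ->
  (forall x, nrm x <= 1 -> nrm (f x) <= nrm (f 1)) /\
  forall x, nrm (f x) <= nrm (f 1) * nrm x.
Proof.
move=> /positive_mapP fpos.
have ball x : nrm x <= 1 -> nrm (f x) <= nrm (f 1) by exact: russo_dye.
split=> // x; apply: le_trans (le_opnorm (linearP f) ball x) _.
by rewrite ler_wpM2r ?nrm_ge0 //; exact: opnorm_le.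
Qed.

Lemma conj_linear f v : linear f -> invertible v ->
  linear (alpha_inv S v \o f \o alpha S v : T -> T).
Proof.
move=> lf iv l x y; rewrite /= !alpha_invE //.
by rewrite (alpha_linear v l x y) lf (alpha_linear _ l).
Qed.

Lemma conj_positive f v : positive_map S f -> invertible v ->
  positive_map S (alpha_inv S v \o f \o alpha S v).
Proof.
move=> /positive_mapP fpos iv; apply/positive_mapP => x px.
by rewrite /= alpha_invE //; apply/alpha_pos/fpos/alpha_pos.
Qed.

Lemma fixpoint_of_spectral_radius (f : {linear T -> T}) (s : R) :
  positive_map S f -> 0 < s -> spectral_radius (f : A -> A) < s ->
  exists w, pos w /\ f w = s%:C *: (w - 1).
Proof.
move=> pf s0 rs; have [_ bf] := positive_bounded pf.
have inv t : s <= t -> op_invertible (fun x : A => t%:C *: x - (f : A -> A) x).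
  apply: (spectral_radius_invertible (c := nrm (f 1)) s0 _ rs) => l cl.
  exact: op_invertible_of_bound (linearP f) bf (nrm_ge0 _) cl.
have [U [lU [_ [_ Ur]]]] := inv s (lexx s).
have e := Ur (s%:S : T); pose w : T := U (s%:S : T).
have {}e : s%:C *: w - f w = s%:S := e.
exists w; split.
  apply: (resolvent_pos (linearP f) (nrm_ge0 (f 1)) s0 bf _ inv).
    exact/positive_mapP.
  by rewrite e; apply/pos_real/ltW.
by rewrite scalerBr -e subKr.
Qed.

Lemma conj_contraction_of_fixpoint (f : {linear T -> T}) (s : R) w :
  positive_map S f -> 0 < s -> pos w -> f w = s%:C *: (w - 1) ->
  exists v, [/\ pos v, invertible v &
    opnorm (alpha_inv S v \o f \o alpha S v : A -> A) < s].
Proof.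
move=> pf s0 pw fw; have /positive_mapP fpos := pf.
have pw1 : pos (w - 1).
  have := posZ (ltW (_ : 0 < s^-1)) (fpos _ pw); rewrite invr_gt0 => /(_ s0).
  by rewrite fw scalerA -rmorphM /= mulVf ?gt_eqF // scale1r.
have iw : invertible w.
  by have := pos_add_invertible pw1 (@ltr01 R); rewrite rmorph1 scale1r addrC subrK.
have [v [pv vv _]] := pos_sqrt pw; have sv : sa v by case: pv.
have iv : invertible v.
  by apply: (@invertible_comm_factor _ _ _ _ v); rewrite ?vv.
exists v; split=> //; have [vu uv] := cinvP iv; set u : T := cinv S v in vu uv.
have su : sa u by exact: sa_inverse vu uv.
pose psi : {linear T -> T} := HB.pack (alpha_inv S v \o f \o alpha S v : T -> T)
  (GRing.isLinear.Build R[i] T T *:%R _ (conj_linear (linearP f) iv)).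
have psi1 : psi 1 = s%:C *: (1 - u * u).
  change (alpha_inv S v (f (star v * (1 * v))) = s%:C *: (1 - u * u)).
  rewrite alpha_invE // sv mul1r vv fw.
  change (star u * (s%:C *: (w - 1) * u) = s%:C *: (1 - u * u)).
  rewrite su scaleAl scaleAr mulrBl mul1r mulrBr -vv.
  by rewrite -(mulrA v) vu mulr1 uv.
(* From 1 <= w <= C, conjugation by u = w^(-1/2) gives 1/C <= u^2 <= 1, so |1 - u^2| <= 1 - 1/C;
   this makes the final inequality strict. *)
pose C := nrm w + 1; have C0 : 0 < C by have := nrm_ge0 w; rewrite /C; lra.
have wC : pos (C%:S - w) by apply: pos_real_sub; [case: pw | rewrite /C; lra].
have uwu : u * (w * u) = 1 by rewrite -vv -(mulrA v) vu mulr1.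
have C1 : C^-1 <= 1 by rewrite invf_le1 // /C; have := nrm_ge0 w; lra.
have le1 : nrm (1 - u * u) <= 1 - C^-1.
  apply: pos_nrm_le; first by rewrite subr_ge0.
    apply: posD; first by apply: pos_real; rewrite subr_ge0.
    have := pos_conj u pw1; rewrite su mulrBl mulrBr uwu mul1r.
    by [].
  have /(posZ (ltW (_ : 0 < C^-1))) := pos_conj u wC; rewrite invr_gt0 => /(_ C0) /pos_eq; apply.
  rewrite su mulrBl mulrBr uwu scaleAl scaleAr mul1r scalerBr scalerA -rmorphM /= mulVf ?gt_eqF //.
  by rewrite scale1r rmorphB rmorph1 /=; module.
have [ball _] := positive_bounded (f := psi) (conj_positive pf iv).
apply: le_lt_trans (opnorm_le ball) _.
rewrite psi1 nrmZ_ge0 ?(ltW s0) // (le_lt_trans (ler_wpM2l (ltW s0) le1)) //.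
by rewrite gtr_pMr // ltrBlDr ltrDl invr_gt0.
Qed.

(** Each l with |l| > [opnorm psi] has a resolvent for psi by the Neumann series, and conjugating
    back gives one for f. *)
Lemma spectral_radius_of_similar (f psi : {linear T -> T}) (s : R) :
  positive_map S psi -> elem_similar S psi f -> opnorm (psi : A -> A) < s ->
  spectral_radius (f : A -> A) < s.
Proof.
move=> ppsi [a [ia psiE]] ns; have [ab ba] := cinvP ia; set b : T := cinv S a in ab ba.
have [ball _] := positive_bounded ppsi.
have bpsi := le_opnorm (linearP psi) ball.
have n0 : 0 <= opnorm (psi : A -> A).
  apply: le_trans (nrm_ge0 (psi 0)) _; apply: ub_le_sup.
    by exists (nrm (psi 1)) => _ [y y1 <-]; exact: ball.
  by exists (0 : A) => //; change (nrm (0 : T) <= 1); rewrite nrm0.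
apply: (spectral_radius_lt n0 ns) => l nl.
apply: (op_invertible_conj (f := psi) ab ba) => [x|].
  by rewrite psiE /= alpha_invE // (alphaK ba) [RHS](alphaK ba).
exact: op_invertible_of_bound (linearP psi) bpsi n0 nl.
Qed.

End Similarity.

(** * The cycle of implications between the four conditions *)

Theorem theorem3p2 (R : realType) (A : completeNormedModType R[i])
    (S : cstar_alg A) (phi : {linear A -> A}) (s : R) :
  positive_map S phi -> 0 < s ->
  [<-> spectral_radius phi < s;
       exists w : A, cpositive S w /\
         phi w = (Complex s 0) *: (w - cone S);
       exists v : A, cstrictly_positive S v /\
         opnorm (alpha_inv S v \o phi \o alpha S v) < s;
       exists psi : {linear A -> A}, positive_map S psi /\
         elem_similar S psi phi /\ opnorm psi < s].
Proof.
move=> pphi s0; tfae.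
- by move=> /(@fixpoint_of_spectral_radius _ _ S phi s pphi s0) [w [/cpositiveP pw wE]]; exists w.
- move=> [w [/cpositiveP pw wE]].
  have [v [pv iv nv]] := @conj_contraction_of_fixpoint _ _ S phi s w pphi s0 pw wE.
  by exists v; split=> //; split=> //; apply/cpositiveP.
- move=> [v [[_ iv] nv]].
  pose psi : {linear A -> A} := HB.pack (alpha_inv S v \o phi \o alpha S v)
    (GRing.isLinear.Build R[i] A A *:%R _ (@conj_linear _ _ S phi v (linearP phi) iv)).
  exists psi; split; first exact: conj_positive.
  by split=> //; exists v.
- by move=> [psi [ppsi [sim npsi]]]; exact: (@spectral_radius_of_similar _ _ S phi psi s).
Qed.
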